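(* Let $q$ be a prime power. Let $r,d\in\mathbb{N}$ be such that $r\geq d$ and $\gcd(r,q-1)=1$. Let $H$ be a polynomial over $\mathbb{F}_{q^2}$ of degree $d$ which permutes $\mathbb{F}_q$. Let $a,b\in\mathbb{F}_{q^2}^\ast$ and $u,v\in\mu_{q+1}$ be such that $u\neq v$ and $\bigl(\frac{u}{v}\bigr)^d\neq\bigl(\frac{a}{b}\bigr)^{q-1}$. Let $w\in\mathbb{F}_{q^2}^\ast$ be such that $w^{q-1}=\frac{u}{v}$. Then $F$ permutes $\mathbb{F}_{q^2}$, where $$F(x)=\begin{cases}aw^{r-d}(v-u)^rx^r&\text{if }x^q-vx=0;\\ \bigl(x^q-vx\bigr)^r\left(aw^{-d}H\left(w\left(\frac{x^q-ux}{x^q-vx}\right)\right)+b\right)&\text{if }x^q-vx\neq 0.\end{cases}$$ In particular, if $\gcd(d,q-1)=1$ and $H(x)=x^d$, then $\widetilde F$ permutes $\mathbb{F}_{q^2}$, where $$\widetilde F(x)=\begin{cases}aw^{r-d}(v-u)^rx^r&\text{if }x^q-vx=0;\\ a\bigl(x^q-vx\bigr)^{r-d}\bigl(x^q-ux\bigr)^d+b\bigl(x^q-vx\bigr)^r&\text{if }x^q-vx\neq 0.\end{cases}$$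
   Context: $\mu_{q+1}\subseteq\mathbb{F}_{q^2}$ is the set of all $(q+1)$-th roots of unity. A polynomial ''permutes'' a set if it induces a bijection of the set to itself. *)

(* Defs.v *)
From mathcomp Require Import all_boot all_order all_algebra.

Set Implicit Arguments.
Unset Strict Implicit.
Unset Printing Implicit Defensive.

Import GRing.Theory.
Local Open Scope ring_scope.

Definition prime_power (q : nat) : Prop :=
  exists p k : nat, [/\ prime p, (0 < k)%N & q = (p ^ k)%N].

Definition permutes_on (T : finType) (A : {set T}) (f : T -> T) : Prop :=
  {in A &, injective f} /\ f @: A = A.

(* Main.v *)
Require Import Defs.
From mathcomp Require Import all_boot all_order all_algebra all_field ring.

Set Implicit Arguments.
Unset Strict Implicit.
Unset Printing Implicit Defensive.

Import GRing.Theory.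
Local Open Scope ring_scope.

(** Put [M x = x^q - v x] and [L x = x^q - u x].  Since [u] and [v] are
    [(q+1)]-th roots of unity, [M x] and [w L x] both lie in the [F_q]-line
    [V = {y | y^q = - y / v}], and [x] is recovered from [(L x, M x)] because
    [L x - M x = (v - u) x].  In both cases [F x = a w^-d alpha + b beta] with
    [beta = (M x)^r] and with [alpha = (w L x)^r] or
    [alpha = (M x)^r H(w L x / M x)], where [alpha] and [beta] lie in the
    [F_q]-line [{y | y^q = (-1/v)^r y}].  The hypothesis on [(u/v)^d] says that
    [a w^-d] and [b] are independent over [F_q], so [F x] determines [alpha]
    and [beta]; as [gcd(r, q-1) = 1], [r]-th powers are injective on [V], and
    [H] is injective on [F_q], so [alpha] and [beta] determine [L x] and [M x]. *)

Section FrobeniusLines.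

Variables (F : fieldType) (q : nat).
Implicit Types c x y A b : F.

Lemma frobenius_line_ratio c x y :
  (0 < q)%N -> x ^+ q = c * x -> y ^+ q = c * y -> (x / y) ^+ q = x / y.
Proof.
move=> q0 hx hy; have [->|y0] := eqVneq y 0.
  by rewrite invr0 mulr0 expr0n gtn_eqF.
have c0 : c != 0.
  apply: contraNneq y0 => c0; move/eqP: hy.
  by rewrite c0 mul0r expf_eq0 => /andP[].
by rewrite expr_div_n hx hy -mulf_div divff // mul1r.
Qed.

(** For [y != 0] the ratio [x / y] is fixed by the [q]-th power, so its order divides both [q - 1]
    and [r], hence is 1. *)
Lemma expf_inj_frobenius_line r c x y :
  (0 < q)%N -> (0 < r)%N -> coprime r (q - 1) ->
  x ^+ q = c * x -> y ^+ q = c * y -> x ^+ r = y ^+ r -> x = y.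
Proof.
move=> q0 r0 cop hx hy hr.
have [y0|y0] := eqVneq y 0.
  by move/eqP: hr; rewrite y0 expr0n gtn_eqF // expf_eq0 r0 => /eqP.
have x0 : x != 0.
  apply: contraNneq y0 => x0; move/esym/eqP: hr.
  by rewrite x0 expr0n gtn_eqF // expf_eq0 r0.
have z0 : x / y != 0 by rewrite mulf_neq0 ?invr_eq0.
have zq : (x / y) ^+ (q - 1) = 1.
  apply: (mulfI z0); rewrite -exprS subn1 prednK // mulr1.
  exact: frobenius_line_ratio hx hy.
have zr : (x / y) ^+ r = 1 by rewrite expr_div_n hr divff // expf_neq0.
have [k l e _] := egcdnP (q - 1) r0.
have: (x / y) ^+ (k * r) = (x / y) ^+ (l * (q - 1) + gcdn r (q - 1)).
  by rewrite e.
rewrite (eqP cop) exprD expr1 !(mulnC _ r) !(mulnC _ (q - 1)%N) !exprM zr zq.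
by rewrite !expr1n mul1r => z1; rewrite -[x](divfK y0) -z1 mul1r.
Qed.

(** A relation with [x != 0] would make [A / b] equal to [- (y / x)], a ratio of two points of one
    line up to sign, hence fixed by the [q]-th power. *)
Lemma frobenius_line_indep c A b x y :
  [pchar F].-nat q -> b != 0 -> (A / b) ^+ q != A / b ->
  x ^+ q = c * x -> y ^+ q = c * y -> A * x + b * y = 0 -> x = 0 /\ y = 0.
Proof.
move=> qF b0 hAb hx hy e; have q0 : (0 < q)%N by case/andP: qF.
have x0 : x = 0.
  apply: contraNeq hAb => x0; have -> : A / b = - (y / x).
    apply/eqP; rewrite -mulNr eqr_div // mulNr -addr_eq0 (mulrC y b).
    exact/eqP.
  by rewrite exprNn_pchar // (frobenius_line_ratio q0 hy hx).
split=> //; move/eqP: e; rewrite x0 mulr0 add0r mulf_eq0 (negPf b0) /=.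
by move/eqP.
Qed.

End FrobeniusLines.

(** The images of [K] already supply [#|K|] roots of ['X^#|K| - 'X]; a further root would exceed its
    degree. *)
Lemma mem_finField_image (K L : finFieldType) (f : {rmorphism K -> L}) (z : L) :
  (z \in [set f c | c : K]) = (z ^+ #|K| == z).
Proof.
apply/imsetP/eqP => [[c _ ->]|hz]; first by rewrite -rmorphXn expf_card.
have K1 : (1 < #|K|)%N := card_finNzRing_gt1 K.
pose p : {poly L} := 'X^#|K| - 'X.
have szp : size p = #|K|.+1.
  by rewrite size_polyDl size_polyXn // size_polyN size_polyX.
have [/existsP[c /eqP ->]|/existsPn zf] := boolP [exists c, z == f c].
  by exists c.
have: (size (z :: map f (enum K)) < size p)%N.
  apply: max_poly_roots; first by rewrite -size_poly_eq0 szp.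
    rewrite /= /root !hornerE hz subrr eqxx /=.
    apply/allP => _ /mapP[c _ ->].
    by rewrite !hornerE -rmorphXn expf_card subrr.
  rewrite /= map_inj_uniq ?enum_uniq ?andbT; last exact: fmorph_inj.
  by apply/mapP => -[c _ e]; case/eqP: (zf c).
by rewrite /= size_map -cardE szp ltnn.
Qed.

Lemma permutes_on_setT (T : finType) (f : T -> T) :
  injective f -> permutes_on [set: T] f.
Proof.
move=> injf; split=> [x y _ _|]; first exact: injf.
by apply/eqP; rewrite eqEcard subsetT card_imset //= leqnn.
Qed.

(** Here the subfield of order [q] appears as the fixed points of the [q]-th power, and [h] is any
    function preserving and injective on them, so that both [H] and the power map [z ^+ d] can be
    substituted. *)
Lemma piecewise_frobenius_inj (F : fieldType) (q r d : nat) (h : F -> F)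
    (a b u v w : F) :
  [pchar F].-nat q -> (forall x : F, x ^+ q ^+ q = x) ->
  (0 < r)%N -> (d <= r)%N -> coprime r (q - 1) ->
  b != 0 -> u ^+ q * u = 1 -> v ^+ q * v = 1 -> u != v -> w != 0 ->
  w ^+ q = u / v * w -> (a * w ^- d / b) ^+ q != a * w ^- d / b ->
  (forall x, x ^+ q = x -> h x ^+ q = h x) ->
  (forall x y, x ^+ q = x -> y ^+ q = y -> h x = h y -> x = y) ->
  injective (fun x : F =>
    if x ^+ q - v * x == 0
    then a * w ^+ (r - d) * (v - u) ^+ r * x ^+ r
    else (x ^+ q - v * x) ^+ r *
         (a * w ^- d * h (w * ((x ^+ q - u * x) / (x ^+ q - v * x))) + b)).
Proof.
move=> qF hF r0 ledr cop b0 hu hv uv w0 hw hA hstab hinj.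
have q0 : (0 < q)%N by case/andP: qF.
have u0 : u != 0.
  by apply: contra_eq_neq hu => ->; rewrite mulr0 eq_sym oner_eq0.
have v0 : v != 0.
  by apply: contra_eq_neq hv => ->; rewrite mulr0 eq_sym oner_eq0.
have powB (x y : F) : (x - y) ^+ q = x ^+ q - y ^+ q.
  by rewrite exprDn_pchar // exprNn_pchar.
pose M (x : F) := x ^+ q - v * x; pose L (x : F) := x ^+ q - u * x.
have lineE (t x : F) : t ^+ q * t = 1 -> t != 0 ->
    (x ^+ q - t * x) ^+ q = - t^-1 * (x ^+ q - t * x).
  move=> ht t0; rewrite powB hF exprMn.
  have -> : t ^+ q = t^-1 by apply: (mulIf t0); rewrite ht mulVf.
  by rewrite mulrBr mulNr mulNr opprK mulKf // addrC.
pose c := - v^-1.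
have hM x : M x ^+ q = c * M x by exact: lineE.
(* [L x] lies on the line with multiplier [- u^-1]; the factor [w] multiplies this by [u / v], which
   gives the multiplier [c] of [M x]. *)
have hL x : (w * L x) ^+ q = c * (w * L x).
  have -> : (w * L x) ^+ q = u / v * w * (- u^-1 * L x).
    by rewrite exprMn hw; congr (_ * _); exact: lineE.
  by rewrite /c; field; rewrite u0 v0.
have hT x : (w * L x / M x) ^+ q = w * L x / M x.
  exact: frobenius_line_ratio (hL x) (hM x).
have expr_line y : y ^+ q = c * y -> (y ^+ r) ^+ q = c ^+ r * y ^+ r.
  by move=> hy; rewrite exprAC hy exprMn.
have LM x : L x - M x = (v - u) * x by rewrite /L /M; ring.
have LMinj x y : L x = L y -> M x = M y -> x = y.
  move=> eL eM; have vu : v - u != 0 by rewrite subr_eq0 eq_sym.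
  by apply: (mulfI vu); rewrite -!LM eL eM.
pose alpha x := if M x == 0 then (w * L x) ^+ r
                else M x ^+ r * h (w * L x / M x).
have halpha x : alpha x ^+ q = c ^+ r * alpha x.
  rewrite /alpha; case: ifP => _; first exact: expr_line.
  by rewrite exprMn expr_line // hstab // mulrA.
have FE x : (if M x == 0
    then a * w ^+ (r - d) * (v - u) ^+ r * x ^+ r
    else M x ^+ r * (a * w ^- d * h (w * (L x / M x)) + b))
    = a * w ^- d * alpha x + b * M x ^+ r.
  rewrite /alpha; case: ifP => [/eqP Mx|_]; last by rewrite mulrA; ring.
  rewrite Mx expr0n gtn_eqF // mulr0 addr0.
  (* When [M x = 0], the first branch is thus [a * w ^- d * (w * L x) ^+ r]. *)
  have -> : L x = (v - u) * x by rewrite -LM Mx subr0.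
  have -> : (w * ((v - u) * x)) ^+ r = w ^+ (r - d) * w ^+ d * (v - u) ^+ r * x ^+ r.
    by rewrite -exprD subnK // !exprMn mulrA.
  by field; rewrite expf_neq0.
move=> x y; rewrite [LHS]FE [RHS]FE => e.
have [ea eb] : alpha x - alpha y = 0 /\ M x ^+ r - M y ^+ r = 0.
  apply: (frobenius_line_indep (c := c ^+ r) qF b0 hA).
  - by rewrite powB !halpha mulrBr.
  - by rewrite powB !expr_line // mulrBr.
  - by apply/eqP; rewrite !mulrBr addrACA -opprD e subrr.
have {}ea : alpha x = alpha y by apply/eqP; rewrite -subr_eq0 ea.
have eM : M x = M y.
  apply: (expf_inj_frobenius_line q0 r0 cop (hM x) (hM y)).
  by apply/eqP; rewrite -subr_eq0 eb.
have wL_inj : w * L x = w * L y -> x = y.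
  by move=> /(mulfI w0) eL; exact: LMinj.
(* Since [M x = M y], both values of [alpha] come from the same branch. *)
move: ea; rewrite /alpha -eM; case: ifPn => [_|M0].
  by move/(expf_inj_frobenius_line q0 r0 cop (hL x) (hL y)).
move/(mulfI (expf_neq0 _ M0)) => eh; apply/wL_inj/(divIf M0).
by rewrite {2}eM; apply: hinj => //; rewrite -eM.
Qed.

Theorem mainTheorem4 (q : nat) (hq : prime_power q)
    (Fq Fq2 : finFieldType) (iota : {rmorphism Fq -> Fq2})
    (cardFq : #|Fq| = q) (cardFq2 : #|Fq2| = (q ^ 2)%N)
    (r d : nat) (d_gt0 : (0 < d)%N) (le_d_r : (d <= r)%N)
    (hr : gcdn r (q - 1) = 1%N)
    (a b u v w : Fq2) (a_neq0 : a != 0) (b_neq0 : b != 0)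
    (hu : (q + 1).-unity_root u) (hv : (q + 1).-unity_root v)
    (u_neq_v : u != v)
    (huvab : (u / v) ^+ d != (a / b) ^+ (q - 1))
    (w_neq0 : w != 0) (hw : w ^+ (q - 1) = u / v) :
  (forall H : {poly Fq2},
     size H = d.+1 ->
     permutes_on [set (iota c : Fq2) | c : Fq] (fun x : Fq2 => H.[x]) ->
     permutes_on [set: Fq2] (fun x : Fq2 =>
       if x ^+ q - v * x == 0
       then a * w ^+ (r - d) * (v - u) ^+ r * x ^+ r
       else (x ^+ q - v * x) ^+ r *
            (a * w ^- d * H.[w * ((x ^+ q - u * x) / (x ^+ q - v * x))] + b)))
  /\
  (gcdn d (q - 1) = 1%N ->
     permutes_on [set: Fq2] (fun x : Fq2 =>
       if x ^+ q - v * x == 0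
       then a * w ^+ (r - d) * (v - u) ^+ r * x ^+ r
       else a * (x ^+ q - v * x) ^+ (r - d) * (x ^+ q - u * x) ^+ d
            + b * (x ^+ q - v * x) ^+ r)).
Proof.
have [p [k [p_pr k_gt0 qE]]] := hq.
have r_gt0 : (0 < r)%N := leq_trans d_gt0 le_d_r.
have pF : p \in [pchar Fq2].
  by apply: (card_finPcharP (n := (k * 2)%N)) p_pr; rewrite cardFq2 qE expnM.
have qF : [pchar Fq2].-nat q.
  by rewrite (eq_pnat _ (pcharf_eq pF)) qE pnatX pnat_id.
have q_gt0 : (0 < q)%N by case/andP: qF.
have Fq2E (x : Fq2) : x ^+ q ^+ q = x.
  by rewrite -exprM -{2}(expf_card x) cardFq2 expnS expn1.
have mem_Fq (z : Fq2) : (z \in [set iota c | c : Fq]) = (z ^+ q == z).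
  by rewrite mem_finField_image cardFq.
have unity_q (t : Fq2) : (q + 1).-unity_root t -> t ^+ q * t = 1.
  by move=> /unity_rootP; rewrite addn1 exprSr.
have exprq (z : Fq2) : z ^+ q = z ^+ (q - 1) * z.
  by rewrite -exprSr subn1 prednK.
have hv1 := unity_q _ hv; have hu1 := unity_q _ hu.
(* Otherwise the nonzero [a * w ^- d / b] has [(q - 1)]-th power 1, so [(a / b) ^+ (q - 1)] equals
   [(w ^+ (q - 1)) ^+ d], that is [(u / v) ^+ d]. *)
have hA : (a * w ^- d / b) ^+ q != a * w ^- d / b.
  have A0 : a * w ^- d / b != 0 by rewrite !mulf_neq0 ?invr_eq0 ?expf_neq0.
  rewrite exprq -subr_eq0 -{3}[a * _ / b]mul1r -mulrBl mulf_eq0 (negPf A0) orbF.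
  rewrite subr_eq0; apply: contra_neq huvab => e1.
  have -> : a / b = a * w ^- d / b * w ^+ d.
    by field; rewrite b_neq0 expf_neq0.
  by rewrite [RHS]exprMn e1 mul1r exprAC hw.
have inj h : (forall z : Fq2, z ^+ q = z -> h z ^+ q = h z) ->
    (forall x y : Fq2, x ^+ q = x -> y ^+ q = y -> h x = h y -> x = y) -> _ :=
  @piecewise_frobenius_inj Fq2 q r d h a b u v w qF Fq2E r_gt0 le_d_r
    (introT eqP hr) b_neq0 hu1 hv1 u_neq_v w_neq0
    (etrans (exprq w) (congr1 (fun z => z * w) hw)) hA.
split=> [H _ [Hinj Him]|hd]; apply: permutes_on_setT.
  apply: (inj (fun z => H.[z])) => [z|x y] hz.
    by apply/eqP; rewrite -mem_Fq -Him imset_f // mem_Fq hz.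
  by move=> hy; apply: Hinj; rewrite mem_Fq ?hz ?hy.
apply: eq_inj (inj (fun z => z ^+ d) _ _) _ => [z hz|y z hy hz|x].
- by rewrite exprAC hz.
(* The fixed points of the [q]-th power form the line with multiplier 1, and [d] is coprime to
   [q - 1]. *)
- by apply: (@expf_inj_frobenius_line _ q d 1); rewrite ?mul1r //; apply/eqP.
case: ifPn => // M0; set M := x ^+ q - v * x in M0 *.
set L := x ^+ q - u * x.
(* The factor [M ^+ d] clears the denominator of [(w * (L / M)) ^+ d], while [w ^- d] cancels
   [w ^+ d]. *)
have -> : M ^+ r = M ^+ (r - d) * M ^+ d by rewrite -exprD subnK.
by rewrite !exprMn exprVn; field; rewrite !expf_neq0.
Qed.
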